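(* The proof system $\mathsf{HPAL}$ is sound and complete for the dynamic logic of contraction updates: for every formula $\varphi\in\mathcal{L}^{\div}$, $\varphi$ is provable in $\mathsf{HPAL}$ if and only if $\varphi$ is valid in the class of all Kripke models (i.e. $\mathcal{M},w\vDash\varphi$ for every Kripke model $\mathcal{M}$ and every world $w$ of $\mathcal{M}$).
   Context: Language. $At$ is a countable set of atoms, $Ag$ a finite set of agents. The contraction language $\mathcal{L}^{\div}$ is given by $\varphi::=\top\mid p\mid\neg\varphi\mid\varphi\wedge\varphi\mid B_a\varphi\mid[\div\varphi]\varphi\mid\forall\varphi$ with $p\in At$, $a\in Ag$; the other Boolean connectives are the usual abbreviations. Semantics. A Kripke model is $\mathcal{M}=(W,R,V)$ with $W\neq\emptyset$, $R_a\subseteq W\times W$ an arbitrary relation for each $a\in Ag$, $V:At\to\wp(W)$; $R_a(w)=\{v:(w,v)\in R_a\}$. Atoms and Booleans are standard; $\mathcal{M},w\vDash B_a\varphi$ iff $\mathcal{M},v\vDash\varphi$ for all $v\in R_a(w)$; $\mathcal{M},w\vDash\forall\varphi$ iff $\mathcal{M},v\vDash\varphi$ for all $v\in W$; $\mathcal{M},w\vDash[\div\varphi]\psi$ iff $\mathcal{M}^{\div\varphi},w\vDash\psi$, where $\mathcal{M}^{\div\varphi}=(W,R^{\div\varphi},V)$ with $R_a^{\div\varphi}(w)=R_a(w)\cup\{v\in W:\mathcal{M},v\vDash\neg\varphi\}$ if $\mathcal{M},w\vDash B_a\varphi$, and $R_a^{\div\varphi}(w)=R_a(w)$ otherwise.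 Proof system $\mathsf{HPAL}$. Axioms (for all $\varphi,\psi,\chi\in\mathcal{L}^{\div}$, $p\in At$, $a\in Ag$): (CL) all classical propositional tautologies; ($\forall$K) $\forall(\varphi\to\psi)\to(\forall\varphi\to\forall\psi)$; ($\forall$T) $\forall\varphi\to\varphi$; ($\forall$5) $\neg\forall\varphi\to\forall\neg\forall\varphi$; ($\forall$B) $\forall\varphi\to B_a\varphi$; (BK) $B_a(\varphi\to\psi)\to(B_a\varphi\to B_a\psi)$; (A1) $[\div\varphi]p\leftrightarrow p$; (A2) $[\div\varphi]\neg\psi\leftrightarrow\neg[\div\varphi]\psi$; (A3) $[\div\varphi](\psi\wedge\chi)\leftrightarrow[\div\varphi]\psi\wedge[\div\varphi]\chi$; (A4) $[\div\varphi]\forall\psi\leftrightarrow\forall[\div\varphi]\psi$; (A5) $[\div\varphi]B_a\psi\leftrightarrow(B_a[\div\varphi]\psi\wedge(B_a\varphi\to\forall(\neg\varphi\to[\div\varphi]\psi)))$. Rules: (MP) from $\varphi$ and $\varphi\to\psi$ infer $\psi$; (RE) from $\varphi\leftrightarrow\psi$ infer $\chi[\varphi/p]\leftrightarrow\chi[\psi/p]$, where $\chi[\varphi/p]$ is the result of substituting $\varphi$ for $p$ everywhere in $\chi$ (including inside the dynamic modalities); (NEC) necessitation for all modalities: from $\varphi$ infer $\forall\varphi$, $B_a\varphi$, and $[\div\psi]\varphi$. *)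

(* Defs.v *)
From mathcomp Require Import all_boot.
From mathcomp Require Import boolp classical_sets.

Set Implicit Arguments.
Unset Strict Implicit.
Unset Printing Implicit Defensive.

Local Open Scope classical_set_scope.

Inductive form (At Ag : Type) : Type :=
| Top
| Atom of At
| Neg of form At Ag
| And of form At Ag & form At Ag
| Bel of Ag & form At Ag
| Ctr of form At Ag & form At Ag
| Univ of form At Ag.

Arguments Top {At Ag}.
Arguments Atom {At Ag} p.

Declare Scope form_scope.
Delimit Scope form_scope with F.
Bind Scope form_scope with form.

Definition Imp At Ag (phi psi : form At Ag) := Neg (And phi (Neg psi)).
Definition Iff At Ag (phi psi : form At Ag) := And (Imp phi psi) (Imp psi phi).

Notation "~~ phi" := (Neg phi) : form_scope.
Notation "phi && psi" := (And phi psi) : form_scope.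
Notation "phi ==> psi" := (Imp phi psi) : form_scope.
Notation "phi <==> psi" := (Iff phi psi) (at level 60, no associativity)
  : form_scope.
Notation "[÷ phi ] psi" := (Ctr phi psi)
  (at level 35, phi at level 200, right associativity, format "[÷ phi ]  psi")
  : form_scope.

Section Semantics.
Variables At Ag : Type.

Record model := Model {
  world : Type;
  world_inh : inhabited world;
  acc : Ag -> world -> set world;
  valuation : At -> set world
}.

(* The contraction M^{÷phi} depends on phi only through its truth set X in M. *)
Definition contract (M : model) (X : set (world M)) : model :=
  {| world := world M;
     world_inh := world_inh M;
     acc := fun a w => if `[< acc a w `<=` X >] then acc a w `|` ~` X
                       else acc a w;
     valuation := @valuation M |}.

Fixpoint sat (phi : form At Ag) (M : model) (w : world M) {struct phi} : Prop :=
  match phi with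
  | Top => True
  | Atom p => valuation p w
  | Neg psi => ~ sat psi w
  | And psi chi => sat psi w /\ sat chi w
  | Bel a psi => forall v, acc a w v -> sat psi v
  | Ctr psi chi => @sat chi (contract [set v : world M | sat psi v]) w
  | Univ psi => forall v : world M, sat psi v
  end.

Definition valid (phi : form At Ag) : Prop :=
  forall (M : model) (w : world M), sat phi w.

Lemma acc_contract (M : model) (phi : form At Ag) (a : Ag) (w : world M) :
  @acc (contract [set v : world M | sat phi v]) a w =
  if `[< sat (Bel a phi) w >] then acc a w `|` [set v | sat (Neg phi) v]
  else acc a w.
Proof. by []. Qed.

End Semantics.

(* Formulas that are neither Top, negations nor conjunctions are treated as
   propositional letters, so the tautologies are exactly the instances in the
   full language of classical propositional tautologies. *)
Fixpoint prop_eval At Ag (v : form At Ag -> bool) (phi : form At Ag) : bool :=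
  match phi with
  | Top => true
  | Neg psi => negb (prop_eval v psi)
  | And psi chi => andb (prop_eval v psi) (prop_eval v chi)
  | _ => v phi
  end.

Definition tautology At Ag (phi : form At Ag) : Prop :=
  forall v : form At Ag -> bool, prop_eval v phi.

Fixpoint subst (At : eqType) (Ag : Type) (p : At) (theta chi : form At Ag) :
    form At Ag :=
  match chi with
  | Top => Top
  | Atom q => if q == p then theta else Atom q
  | Neg psi => Neg (subst p theta psi)
  | And psi1 psi2 => And (subst p theta psi1) (subst p theta psi2)
  | Bel a psi => Bel a (subst p theta psi)
  | Ctr psi1 psi2 => Ctr (subst p theta psi1) (subst p theta psi2)
  | Univ psi => Univ (subst p theta psi)
  end.

Inductive HPAL (At : eqType) (Ag : Type) : form At Ag -> Prop :=
| CL phi : tautology phi -> HPAL phi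
| UnivK phi psi : HPAL (Univ (phi ==> psi) ==> (Univ phi ==> Univ psi))
| UnivT phi : HPAL (Univ phi ==> phi)
| Univ5 phi : HPAL (~~ Univ phi ==> Univ (~~ Univ phi))
| UnivB a phi : HPAL (Univ phi ==> Bel a phi)
| BelK a phi psi : HPAL (Bel a (phi ==> psi) ==> (Bel a phi ==> Bel a psi))
| CtrAtom phi p : HPAL ([÷ phi] Atom p <==> Atom p)
| CtrNeg phi psi : HPAL ([÷ phi] (~~ psi) <==> ~~ ([÷ phi] psi))
| CtrAnd phi psi chi :
    HPAL ([÷ phi] (psi && chi) <==> ([÷ phi] psi && [÷ phi] chi))
| CtrUniv phi psi : HPAL ([÷ phi] (Univ psi) <==> Univ ([÷ phi] psi))
| CtrBel a phi psi :
    HPAL ([÷ phi] (Bel a psi) <==>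
          (Bel a ([÷ phi] psi) &&
           (Bel a phi ==> Univ (~~ phi ==> [÷ phi] psi))))
| MP phi psi : HPAL phi -> HPAL (phi ==> psi) -> HPAL psi
| RE phi psi chi p :
    HPAL (phi <==> psi) -> HPAL (subst p phi chi <==> subst p psi chi)
| NecUniv phi : HPAL phi -> HPAL (Univ phi)
| NecBel a phi : HPAL phi -> HPAL (Bel a phi)
| NecCtr psi phi : HPAL phi -> HPAL ([÷ psi] phi).

(* Main.v *)
Require Import Defs.
From mathcomp Require Import all_boot.
From mathcomp Require Import boolp classical_sets.

(** The axioms (A1)-(A5) rewrite every formula into a provably equivalent one
    without contraction modalities, so completeness reduces to that of the
    static logic: K for each [Bel a], S5 for [Univ], and the inclusion axiom
    [Univ phi ==> Bel a phi]. For the latter, an unprovable formula fails at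
    some maximal consistent theory, and the canonical model is cut down to the
    theories having the same [Univ]-formulas as that one, so that [Univ]
    quantifies over all worlds. Working with theories (sets of formulas
    containing all theorems and closed under modus ponens) makes the deduction
    lemma trivial: adjoining [a] to [T] gives [[set b | T (a ==> b)]]. *)

Set Implicit Arguments.
Unset Strict Implicit.
Unset Printing Implicit Defensive.

Local Open Scope classical_set_scope.

Ltac tauto_form :=
  let v := fresh "v" in
  move=> v /=;
  repeat match goal with |- context [prop_eval v ?x] =>
    case: (prop_eval v x) end;
  repeat match goal with |- context [v ?x] => case: (v x) end;
  done.

(** * Soundness of the axioms and rules *)

Section Soundness.
Variables (At : eqType) (Ag : Type).
Implicit Types (phi psi chi : form At Ag) (M : model At Ag).

Lemma sat_Imp phi psi M (w : world M) :
  sat (phi ==> psi)%F w <-> (sat phi w -> sat psi w).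
Proof.
split=> /= [h hphi|h [hphi]]; last by apply; exact: h.
by apply: contrapT => hpsi; apply: h.
Qed.

Lemma sat_Iff phi psi M (w : world M) :
  sat (phi <==> psi)%F w <-> (sat phi w <-> sat psi w).
Proof.
split=> [[/sat_Imp h1 /sat_Imp h2] //|[h1 h2]].
by split; apply/sat_Imp.
Qed.

Lemma valid_Iff phi psi :
  valid (phi <==> psi)%F <->
  forall M (w : world M), sat phi w <-> sat psi w.
Proof. by split=> h M w; apply/sat_Iff/h. Qed.

Lemma tautology_valid phi : tautology phi -> valid phi.
Proof.
(* Truth at [w] is itself a propositional valuation, with atoms and modal formulas as letters. *)
move=> taut M w; pose v chi := `[< sat chi w >].
suff <- : prop_eval v phi <-> sat phi w by exact: taut.
elim: {taut} phi => [|p|psi IH|psi IH1 chi IH2|a psi _|psi _ chi _|psi _] /=.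
- by [].
- by split=> /asboolP.
- by rewrite -IH; split=> /negP.
- by rewrite -IH1 -IH2; split=> /andP.
- by split=> /asboolP.
- by split=> /asboolP.
- by split=> /asboolP.
Qed.

(** Induction on [chi] with the model kept general, since a contraction in [chi] changes the model
    in which its second argument is evaluated. *)
Lemma valid_subst p phi psi chi : valid (phi <==> psi)%F ->
  valid (subst p phi chi <==> subst p psi chi)%F.
Proof.
move=> /valid_Iff eqv; apply/valid_Iff.
elim: chi => //= [q|chi IH|chi1 IH1 chi2 IH2|a chi IH|chi1 IH1 chi2 IH2|chi IH]
  M w.
- by case: ifP => // _; exact: eqv.
- by rewrite IH.
- by rewrite IH1 IH2.
- by split=> h v /h /IH.
(* Equal truth sets give literally the same contracted model, so [IH2] applies there. *)
- suff -> : [set v : world M | sat (subst p phi chi1) v] =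
            [set v | sat (subst p psi chi1) v] by exact: IH2.
  by apply/seteqP; split=> v /IH1.
- by split=> h v; apply/IH.
Qed.

(** If [Bel a phi] holds at [w], the new successors are exactly the worlds refuting [phi], which the
    second conjunct covers; otherwise the relation at [w] is unchanged and that conjunct is
    vacuous. *)
Lemma valid_CtrBel a phi psi :
  valid ([÷ phi] (Bel a psi) <==>
    (Bel a ([÷ phi] psi) && (Bel a phi ==> Univ (~~ phi ==> [÷ phi] psi))))%F.
Proof.
apply/valid_Iff => M w.
set chi : form At Ag := ([÷ phi] psi)%F.
have -> : sat ([÷ phi] (Bel a psi))%F w <->
  (forall v, @acc _ _ (contract [set v : world M | sat phi v]) a w v ->
     sat chi (v : world M)) by [].
have impP := sat_Imp (Bel a phi) (Univ (~~ phi ==> chi))%F w.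
have chiP := sat_Imp (~~ phi)%F chi.
rewrite acc_contract; case: asboolP => hphi; split.
- move=> h; split=> [v av|]; first by apply: h; left.
  by apply/impP => _ v; apply/chiP => nphi; apply: h; right.
- move=> [h1 /impP h2] v [/h1 //|nphi].
  by move: (h2 hphi v) => /chiP; apply.
- by move=> h; split=> //; apply/impP => /hphi.
- by case.
Qed.

Lemma HPAL_sound phi : HPAL phi -> valid phi.
Proof.
elim=> {phi}.
- exact: tautology_valid.
- move=> phi psi M w; apply/sat_Imp => h; apply/sat_Imp => h' v.
  by move: (h v) => /sat_Imp; apply; exact: h'.
- by move=> phi M w; apply/sat_Imp => h; exact: h.
- by move=> phi M w; apply/sat_Imp => h _; exact: h.
- by move=> a phi M w; apply/sat_Imp => h v _; exact: h.
- move=> a phi psi M w; apply/sat_Imp => h; apply/sat_Imp => h' v av.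
  by move: (h v av) => /sat_Imp; apply; exact: h'.
- by move=> phi p; apply/valid_Iff.
- by move=> phi psi; apply/valid_Iff.
- by move=> phi psi chi; apply/valid_Iff.
- by move=> phi psi; apply/valid_Iff.
- exact: valid_CtrBel.
- by move=> phi psi _ h1 _ h2 M w; move: (h2 M w) => /sat_Imp; apply.
- by move=> phi psi chi p _; exact: valid_subst.
- by move=> phi _ h M w v; exact: h.
- by move=> a phi _ h M w v _; exact: h.
- by move=> psi phi _ h M w; exact: h.
Qed.

End Soundness.

(** * Theories, maximal theories and Lindenbaum's lemma *)

Section Theories.
Variables (At : eqType) (Ag : Type).
Implicit Types (a b c x y z : form At Ag) (T : set (form At Ag)).

Record theory T : Prop := Theory {
  theory_HPAL : forall a, HPAL a -> T a;
  theory_MP : forall a b, T a -> T (a ==> b)%F -> T b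
}.

Lemma HPAL_theory : theory (@HPAL At Ag).
Proof. by split=> // a b; exact: MP. Qed.

Lemma theory_taut1 T a b : theory T -> tautology (a ==> b)%F -> T a -> T b.
Proof.
by move=> thT tab Ta; apply: (theory_MP thT Ta); apply/(theory_HPAL thT)/CL.
Qed.

Lemma theory_taut2 T a b c : theory T ->
  tautology (a ==> (b ==> c))%F -> T a -> T b -> T c.
Proof.
move=> thT tabc Ta Tb; apply: (theory_MP thT Tb).
exact: (theory_taut1 thT tabc).
Qed.

Lemma theory_adjoin T a : theory T -> theory [set b | T (a ==> b)%F].
Proof.
move=> thT; split=> [b /(theory_HPAL thT)|b c].
- by apply: (theory_taut1 thT); tauto_form.
- by apply: (theory_taut2 thT); tauto_form.
Qed.

Lemma theory_Bel T i : theory T -> theory [set b | T (Bel i b)].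
Proof.
move=> thT; split=> [b hb|b c /= hb hbc].
  by apply/(theory_HPAL thT)/NecBel.
by apply: (theory_MP thT hb); apply/(theory_MP thT hbc)/(theory_HPAL thT)/BelK.
Qed.

Lemma theory_Univ T : theory T -> theory [set b | T (Univ b)].
Proof.
move=> thT; split=> [b hb|b c /= hb hbc].
  by apply/(theory_HPAL thT)/NecUniv.
by apply: (theory_MP thT hb); apply/(theory_MP thT hbc)/(theory_HPAL thT)/UnivK.
Qed.

Record maximal T : Prop := Maximal {
  maximal_theory :> theory T;
  maximal_Neg : forall a, T (~~ a)%F <-> ~ T a
}.

(** Zorn's lemma yields a theory maximal among those that contain [T] and omit [c]; it decides every
    formula. *)
Lemma lindenbaum T c : theory T -> ~ T c ->
  exists A, [/\ maximal A, T `<=` A & ~ A c].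
Proof.
move=> thT nTc.
pose good A := [/\ theory A, T `<=` A & ~ A c].
(* The disjunct [A = set0] accounts for the union of the empty chain. *)
have [F Fgood Ftot|A [[A0|goodA] Amax]] :=
    @Zorn_bigcup _ [set A | A = set0 \/ good A].
- have [[X [FX goodX]]|noX] := pselect (exists X, F X /\ good X); last first.
    left; rewrite -subset0 => a [X FX Xa].
    case: (Fgood _ FX) => [X0|goodX]; first by rewrite X0 in Xa.
    by apply: noX; exists X.
  have goodF Y a : F Y -> Y a -> good Y.
    by move=> FY Ya; case: (Fgood _ FY) => // Y0; rewrite Y0 in Ya.
  right; split.
  + split=> [a ha|a b [Y FY Ya] [Z FZ Zab]].
      by exists X => //; case: goodX => thX _ _; exact: theory_HPAL.
    have [thY _ _] := goodF _ _ FY Ya; have [thZ _ _] := goodF _ _ FZ Zab.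
    case: (Ftot _ _ FY FZ) => [YZ|ZY].
    * by exists Z => //; apply: (theory_MP thZ) Zab; exact: YZ.
    * by exists Y => //; apply: (theory_MP thY Ya); exact: ZY.
  + by case: goodX => _ TX _ a /TX Xa; exists X.
  + by move=> [Y FY Yc]; case: (goodF _ _ FY Yc).
(* The maximal set cannot be empty, as [T] itself is good and nonempty. *)
- have ttop : T Top by apply/(theory_HPAL thT)/CL.
  have AT : A `<` T by rewrite A0; split=> // /(_ _ ttop).
  by case: (Amax T AT); right; split.
- have [thA TA nAc] := goodA; exists A; split=> //.
  (* Otherwise adjoining [a] to [A] would give a strictly larger theory that still omits [c]. If
     neither [a] nor its negation were in [A], both would imply [c], forcing [c] into [A]. *)
  have imp_c a : ~ A a -> A (a ==> c)%F.
    move=> nAa; apply: contrapT => nAac.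
    have AB : A `<=` [set b | A (a ==> b)%F].
      by move=> b; apply: (theory_taut1 thA); tauto_form.
    apply: (Amax [set b | A (a ==> b)%F]).
      split=> // /(_ a); apply: contra_not nAa; apply.
      by apply/(theory_HPAL thA)/CL; tauto_form.
    right; split=> //; first exact: theory_adjoin.
    by move=> b /TA /AB.
  split=> // a; split=> [Ana Aa|nAa].
    by apply: nAc; apply: (theory_taut2 thA _ Ana Aa); tauto_form.
  apply: contrapT => nAna; apply: nAc.
  by apply: (theory_taut2 thA _ (imp_c _ nAa) (imp_c _ nAna)); tauto_form.
Qed.

(** The usual S5 derivation of axiom 4: contraposed T, then 5, then contraposed 5 under [Univ]. *)
Lemma HPAL_Univ4 a : HPAL (Univ a ==> Univ (Univ a))%F.
Proof.
have imp_trans x y z : HPAL (x ==> y)%F -> HPAL (y ==> z)%F -> HPAL (x ==> z)%F.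
  by apply: (theory_taut2 HPAL_theory); tauto_form.
have contra x y : HPAL (x ==> ~~ y)%F -> HPAL (y ==> ~~ x)%F.
  by apply: (theory_taut1 HPAL_theory); tauto_form.
have contraN x y : HPAL (~~ x ==> y)%F -> HPAL (~~ y ==> x)%F.
  by apply: (theory_taut1 HPAL_theory); tauto_form.
apply: (imp_trans _ _ _ (contra _ _ (UnivT (~~ Univ a)%F))).
apply: (imp_trans _ _ _ (Univ5 _)).
by apply: MP (UnivK _ _); apply/NecUniv/contraN; exact: Univ5.
Qed.

End Theories.

(** * Elimination of the contraction modalities *)

Section Reduction.
Variables (At : eqType) (Ag : Type).
Implicit Types (phi psi chi theta : form At Ag).

Fixpoint static (phi : form At Ag) : bool :=
  match phi with
  | Top | Atom _ => true
  | Neg psi | Bel _ psi | Univ psi => static psi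
  | And psi chi => static psi && static chi
  | Ctr _ _ => false
  end.

Let thH := @HPAL_theory At Ag.

Lemma Iff_refl phi : HPAL (phi <==> phi)%F.
Proof. by apply: CL; tauto_form. Qed.

Lemma Iff_trans phi psi chi :
  HPAL (phi <==> psi)%F -> HPAL (psi <==> chi)%F -> HPAL (phi <==> chi)%F.
Proof. by apply: (theory_taut2 thH); tauto_form. Qed.

Lemma Iff_intro phi psi :
  HPAL (phi ==> psi)%F -> HPAL (psi ==> phi)%F -> HPAL (phi <==> psi)%F.
Proof. by apply: (theory_taut2 thH); tauto_form. Qed.

Lemma Iff_sides phi psi :
  HPAL (phi <==> psi)%F -> HPAL (phi ==> psi)%F /\ HPAL (psi ==> phi)%F.
Proof. by move=> h; split; apply: (theory_taut1 thH _ h); tauto_form. Qed.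

Lemma Iff_Neg phi psi :
  HPAL (phi <==> psi)%F -> HPAL (~~ phi <==> ~~ psi)%F.
Proof. by apply: (theory_taut1 thH); tauto_form. Qed.

Lemma Iff_And phi psi chi theta :
  HPAL (phi <==> psi)%F -> HPAL (chi <==> theta)%F ->
  HPAL ((phi && chi) <==> (psi && theta))%F.
Proof. by apply: (theory_taut2 thH); tauto_form. Qed.

Lemma Iff_Imp phi psi chi theta :
  HPAL (phi <==> psi)%F -> HPAL (chi <==> theta)%F ->
  HPAL ((phi ==> chi) <==> (psi ==> theta))%F.
Proof. by apply: (theory_taut2 thH); tauto_form. Qed.

Lemma Iff_Bel a phi psi :
  HPAL (phi <==> psi)%F -> HPAL (Bel a phi <==> Bel a psi)%F.
Proof.
move=> /Iff_sides[h1 h2].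
by apply: Iff_intro; apply: MP (BelK _ _ _); exact: NecBel.
Qed.

Lemma Iff_Univ phi psi :
  HPAL (phi <==> psi)%F -> HPAL (Univ phi <==> Univ psi)%F.
Proof.
move=> /Iff_sides[h1 h2].
by apply: Iff_intro; apply: MP (UnivK _ _); exact: NecUniv.
Qed.

(** The modality commutes with negation and conjunction, hence with [Imp]. With necessitation this
    gives replacement in the scope of [[÷ phi]] without (RE). *)
Lemma HPAL_CtrK phi psi chi :
  HPAL ([÷ phi] (psi ==> chi) ==> ([÷ phi] psi ==> [÷ phi] chi))%F.
Proof.
have := Iff_And (Iff_refl ([÷ phi] psi)%F) (CtrNeg phi chi).
move=> /(Iff_trans (CtrAnd phi psi (~~ chi)%F))/Iff_Neg.
move=> /(Iff_trans (CtrNeg phi (psi && ~~ chi)%F)).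
by case/Iff_sides.
Qed.

Lemma Iff_Ctr phi psi chi :
  HPAL (psi <==> chi)%F -> HPAL ([÷ phi] psi <==> [÷ phi] chi)%F.
Proof.
move=> /Iff_sides[h1 h2].
by apply: Iff_intro; apply: MP (HPAL_CtrK _ _ _); exact: NecCtr.
Qed.

(* Contracting by the given [phi] rather than by its static equivalent [phi']
   avoids replacement inside [[÷ _]]: that would need (RE), which has no
   instances when there are no atoms. *)
Lemma static_Ctr phi phi' chi : static phi' -> HPAL (phi <==> phi')%F ->
  static chi -> exists2 theta, static theta & HPAL ([÷ phi] chi <==> theta)%F.
Proof.
move=> st' eqphi; elim: chi =>
  //= [_|p _|psi IH /IH[t st eqt]||a psi IH /IH[t st eqt]|psi IH /IH[t st eqt]].
(* No reduction axiom treats [Top]; necessitation makes both sides theorems. *)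
- exists Top => //; have hTop : HPAL (@Top At Ag) by apply: CL.
  by apply: (theory_taut2 thH _ hTop (NecCtr phi hTop)); tauto_form.
- by exists (Atom p) => //; exact: CtrAtom.
- exists (~~ t)%F => //.
  exact: Iff_trans (CtrNeg _ _) (Iff_Neg eqt).
- move=> psi1 IH1 psi2 IH2 /andP[/IH1[t1 st1 eqt1] /IH2[t2 st2 eqt2]].
  exists (t1 && t2)%F => /=; first by rewrite st1.
  exact: Iff_trans (CtrAnd _ _ _) (Iff_And eqt1 eqt2).
- exists (Bel a t && (Bel a phi' ==> Univ (~~ phi' ==> t)))%F => /=.
    by rewrite st st'.
  apply: Iff_trans (CtrBel _ _ _) _; apply: Iff_And; first exact: Iff_Bel.
  apply: Iff_Imp; first exact: Iff_Bel.
  by apply/Iff_Univ/Iff_Imp => //; exact: Iff_Neg.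
- exists (Univ t) => //.
  exact: Iff_trans (CtrUniv _ _) (Iff_Univ eqt).
Qed.

Lemma static_form phi :
  exists2 theta, static theta & HPAL (phi <==> theta)%F.
Proof.
elim: phi => [|p|psi [t st eqt]|psi1 [t1 st1 eqt1] psi2 [t2 st2 eqt2]
             |a psi [t st eqt]|psi1 [t1 st1 eqt1] psi2 [t2 st2 eqt2]
             |psi [t st eqt]].
- by exists Top => //; exact: Iff_refl.
- by exists (Atom p) => //; exact: Iff_refl.
- by exists (~~ t)%F => //; exact: Iff_Neg.
- by exists (t1 && t2)%F; [rewrite /= st1|exact: Iff_And].
- by exists (Bel a t) => //; exact: Iff_Bel.
- have [t st eqt] := static_Ctr st1 eqt1 st2.
  by exists t => //; exact: Iff_trans (Iff_Ctr _ eqt2) eqt.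
- by exists (Univ t) => //; exact: Iff_Univ.
Qed.

End Reduction.

(** * The canonical model and its truth lemma *)

Section CanonicalModel.
Variables (At : eqType) (Ag : Type) (G : set (form At Ag)).
Hypothesis maxG : maximal G.
Implicit Types (A B : set (form At Ag)) (phi psi : form At Ag).

Definition same_Univ A : Prop := forall psi, A (Univ psi) <-> G (Univ psi).

Definition canonical_world : Type := {A | maximal A /\ same_Univ A}.

Definition canonical_root : canonical_world :=
  exist _ G (conj maxG (fun=> iff_refl _)).

Definition canonical : model At Ag := {|
  world := canonical_world;
  world_inh := inhabits canonical_root;
  acc := fun a u => [set v : canonical_world |
    forall psi, sval u (Bel a psi) -> sval v psi];
  valuation := fun p => [set u : canonical_world | sval u (Atom p)] |}.

(** Axiom 4 carries [Univ psi] from [A] to [B], and axiom 5 carries its negation. *)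
Lemma same_Univ_sub A B : maximal A -> maximal B -> same_Univ A ->
  (forall psi, A (Univ psi) -> B psi) -> same_Univ B.
Proof.
move=> mA mB eqA AB psi; rewrite -eqA; split=> [Bpsi|Apsi].
- apply: contrapT => /(maximal_Neg mA) nApsi.
  have /AB/(maximal_Neg mB) : A (Univ (~~ Univ psi)%F) by
    apply: (theory_MP mA nApsi); apply/(theory_HPAL mA)/Univ5.
  exact.
- apply: AB; apply: (theory_MP mA Apsi).
  exact/(theory_HPAL mA)/HPAL_Univ4.
Qed.

(** The existence lemma for both modalities: [T] will be the set of [b] with [Bel i b], or with
    [Univ b], in [A]. The condition on [Univ phi] keeps the witness a world of the restricted
    model. *)
Lemma canonical_witness (A : canonical_world) T psi : theory T ->
  (forall phi, sval A (Univ phi) -> T phi) -> ~ T psi ->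
  exists B : canonical_world, T `<=` sval B /\ ~ sval B psi.
Proof.
case: A => A [mA eqA] /= thT AT /(lindenbaum thT)[B [mB TB nB]].
suff eqB : same_Univ B by exists (exist _ B (conj mB eqB)).
by apply: same_Univ_sub eqA _ => // phi /AT /TB.
Qed.

Lemma truth_lemma phi : static phi ->
  forall A : world canonical, sat phi A <-> sval A phi.
Proof.
have mx (A : canonical_world) : maximal (sval A) := (svalP A).1.
elim: phi => [|p|psi IH|psi1 IH1 psi2 IH2|a psi IH|//|psi IH] /=.
- by move=> _ A; split=> // _; apply/(theory_HPAL (mx A))/CL.
- by [].
- by move=> /IH{}IH A; rewrite IH (maximal_Neg (mx A)).
- move=> /andP[/IH1{}IH1 /IH2{}IH2] A; rewrite IH1 IH2.
  split=> [[h1 h2]|h].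
    by apply: (theory_taut2 (mx A) _ h1 h2); tauto_form.
  by split; apply: (theory_taut1 (mx A) _ h); tauto_form.
- move=> /IH{}IH A; split=> [h|h B AB]; last by apply/IH/AB.
  apply: contrapT => nA.
  (* The inclusion axiom puts the belief witness among the worlds sharing the [Univ]-formulas of
     [G]. *)
  have sub chi : sval A (Univ chi) -> sval A (Bel a chi).
    move=> hchi; apply: (theory_MP (mx A) hchi).
    exact/(theory_HPAL (mx A))/UnivB.
  have [B [AB nB]] := canonical_witness (theory_Bel a (mx A)) sub nA.
  by apply/nB/IH/h.
- move=> /IH{}IH A; split=> [h|h B].
    apply: contrapT => nA.
    have [B [_ nB]] := canonical_witness (theory_Univ (mx A)) (fun _ => id) nA.
    by apply/nB/IH/h.
  apply/IH; suff hB : sval B (Univ psi) by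
    apply: (theory_MP (mx B) hB); apply/(theory_HPAL (mx B))/UnivT.
  by apply/((svalP B).2)/((svalP A).2).
Qed.

End CanonicalModel.

(** * Completeness, first for static formulas and then for all *)

Lemma static_complete (At : eqType) (Ag : Type) (phi : form At Ag) :
  static phi -> valid phi -> HPAL phi.
Proof.
move=> st val; apply: contrapT => /(lindenbaum (@HPAL_theory At Ag)).
move=> [G [maxG _ nG]]; apply: nG.
exact/(truth_lemma st (canonical_root maxG))/val.
Qed.

Theorem theorem4p2 (At : countType) (Ag : finType) (phi : form At Ag) :
  HPAL phi <-> valid phi.
Proof.
split=> [|val]; first exact: HPAL_sound.
have [theta st eqt] := static_form phi.
have /Iff_sides[_ imp] := eqt; apply: MP imp.
apply: static_complete => // M w.
(* Soundness of the provable equivalence transfers validity from [phi] to [theta]. *)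
by move/HPAL_sound/valid_Iff: eqt => <-; exact: val.
Qed.
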